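(* Let $\phi:\mathbb{R}^n\to\mathbb{R}$ be either $\phi(x)=\sum_{i=1}^n(\cosh(x_i)-1)$ or $\phi(x)=\cosh(\|x\|)-1$. Then for all $y,\bar y\in\mathbb{R}^n$ $$\phi(\nabla\phi^*(y)-\nabla\phi^*(\bar y))\le\tfrac12\|y-\bar y\|^2 .$$ Therefore, for $f:\mathbb{R}^n\to\mathbb{R}$ continuously differentiable, $x\in\mathbb{R}^n$ and a random vector $g(x)\in\mathbb{R}^n$, if $\mathbb{E}[\|\nabla f(x)-g(x)\|^2]\le\sigma^2$, then $$\mathbb{E}\left[\phi\big(\nabla\phi^*(\nabla f(x))-\nabla\phi^*(g(x))\big)\right]\le\frac{\sigma^2}{2}.$$
   Context: $\|\cdot\|$ is the Euclidean norm on $\mathbb{R}^n$; $\phi^*$ is the convex conjugate of $\phi$. The random vector $g(x)$ is a stochastic gradient of $f$ at $x$ returned by a stochastic first-order oracle. *)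

(* Defs.v *)
From HB Require Import structures.
From mathcomp Require Import all_boot all_order all_algebra.
From mathcomp Require Import all_classical all_reals all_analysis.

Set Implicit Arguments.
Unset Strict Implicit.
Unset Printing Implicit Defensive.

Import Order.TTheory GRing.Theory Num.Theory.
Import numFieldNormedType.Exports.

Local Open Scope classical_set_scope.
Local Open Scope ring_scope.

Definition dot (R : realType) (n : nat) (u v : 'rV[R]_n) : R :=
  \sum_(i < n) u 0 i * v 0 i.

(* The library norm on row vectors is the sup norm.  It induces the same
   topology, and the same notion of differentiability, as this one. *)
Definition enorm (R : realType) (n : nat) (v : 'rV[R]_n) : R :=
  Num.sqrt (dot v v).

Definition cosh (R : realType) (r : R) : R := (expR r + expR (- r)) / 2.

Definition cosh_sum (R : realType) (n : nat) (x : 'rV[R]_n) : R :=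
  \sum_(i < n) (cosh (x 0 i) - 1).

Definition cosh_enorm (R : realType) (n : nat) (x : 'rV[R]_n) : R :=
  cosh (enorm x) - 1.

Definition convex_conjugate (R : realType) (n : nat) (phi : 'rV[R]_n -> R)
    (y : 'rV[R]_n) : \bar R :=
  ereal_sup [set (dot y x - phi x)%:E | x in [set: 'rV[R]_n]].

Definition gradient (R : realType) (n : nat) (f : 'rV[R]_n -> R)
    (x : 'rV[R]_n) : 'rV[R]_n :=
  \row_(i < n) 'D_(delta_mx 0 i) f x.

(* [fine] is the projection from extended reals to reals, which is harmless
   where the conjugate is finite. *)
Definition grad_conjugate (R : realType) (n : nat) (phi : 'rV[R]_n -> R)
    (y : 'rV[R]_n) : 'rV[R]_n :=
  gradient (fun z => fine (convex_conjugate phi z)) y.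

Definition continuously_differentiable (R : realType) (n : nat)
    (f : 'rV[R]_n -> R) : Prop :=
  (forall x, differentiable f x) /\ continuous (gradient f).

(* Measurability for the Borel sigma-algebra of R^n, which is not a canonical
   instance on row vectors. *)
Definition random_vector (R : realType) (n : nat) (d : measure_display)
    (T : measurableType d) (X : T -> 'rV[R]_n) : Prop :=
  measurable_fun [set: T]
    (X : T -> g_sigma_algebraType [set U : set 'rV[R]_n | open U]).

(* Main.v *)
Require Import Defs.
From HB Require Import structures.
From mathcomp Require Import all_boot all_order all_algebra.
From mathcomp Require Import all_classical all_reals all_analysis measurable_realfun.
From mathcomp Require Import ring lra.

(** If [x y] maximises [z |-> <y, z> - phi z], then the increments of the
    conjugate of [phi] satisfy
    [<z - y, x y> <= phi^* z - phi^* y <= <z - y, x z>], so that continuity of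
    [x] forces [x] to be the gradient of [phi^*].  For both choices of [phi] the
    maximiser is explicit ([asinh] coordinatewise, resp. [asinh |y| / |y|] times
    [y]), and its continuity follows from the inequality to be proved, since
    [phi] dominates a multiple of the squared norm.

    In one variable the inequality reads
    [sqrt (1 + a^2) * sqrt (1 + b^2) - a * b - 1 <= (a - b)^2 / 2], which is
    AM-GM.  In the radial case, let [c] be the cosine of the angle between the
    two vectors.  The left-hand side is a convex function of [c] because
    [t |-> cosh (sqrt t)] is convex (its power series has nonnegative
    coefficients), and the right-hand side is affine in [c].  This reduces the
    inequality to [c = 1] and [c = -1], which are one-variable cases. *)

Set Implicit Arguments.
Unset Strict Implicit.
Unset Printing Implicit Defensive.

Import Order.TTheory GRing.Theory Num.Theory.
Import numFieldNormedType.Exports.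

Local Open Scope classical_set_scope.
Local Open Scope ring_scope.

(** * One-variable facts on [cosh] and its inverse slope [asinh] *)

Section HyperbolicFunctions.
Variable R : realType.
Implicit Types r s x y z a b l m : R.

Lemma coshN x : cosh (- x) = cosh x.
Proof. by rewrite /cosh opprK addrC. Qed.

(** Average the tangent-line bounds for [expR] at [a] and at [- a], both instances of
    [1 + t <= expR t]. *)
Lemma cosh_tangent_le x a :
  cosh a + (expR a - expR (- a)) / 2 * (x - a) <= cosh x.
Proof.
have tangent (u v : R) : expR u * (1 + (v - u)) <= expR v.
  rewrite [leRHS](_ : _ = expR u * expR (v - u)); last by rewrite -expRD subrKC.
  by rewrite ler_pM2l ?expR_gt0// expR_ge1Dx.
have := tangent a x; have := tangent (- a) (- x).
rewrite /cosh; lra.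
Qed.

Lemma sqr_le_cosh x : x ^+ 2 <= 8 * (cosh x - 1).
Proof.
wlog x0 : x / 0 <= x => [hw|].
  have [/hw//|/ltW x0] := leP 0 x.
  by rewrite -sqrrN -coshN hw ?oppr_ge0.
have h1 : 1 + x / 2 <= expR (x / 2) by exact: expR_ge1Dx.
have h2 : expR (- (x / 2)) <= 1 by rewrite expR_le1; lra.
have h3 : expR (x / 2) * expR (- (x / 2)) = 1 by rewrite -expRD subrr expR0.
(* This is [cosh x - 1 = 2 sinh(x/2)^2]. The crude bound [2 sinh(x/2) >= x/2] from [h1] and [h2]
   yields the constant 8; any constant would do for continuity. *)
have -> : 8 * (cosh x - 1) = (2 * (expR (x / 2) - expR (- (x / 2)))) ^+ 2.
  rewrite /cosh {1 2}(_ : x = x / 2 + x / 2); last by lra.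
  by rewrite opprD !expRD; lra.
by rewrite lerXn2r ?nnegrE; lra.
Qed.

Lemma cosh_ge1 x : 1 <= cosh x.
Proof. by have := sqr_le_cosh x; have := sqr_ge0 x; lra. Qed.

Definition asinh x := ln (x + Num.sqrt (1 + x ^+ 2)).

Lemma sqr_sqrt1D x : Num.sqrt (1 + x ^+ 2) ^+ 2 = 1 + x ^+ 2.
Proof. by rewrite sqr_sqrtr// addr_ge0// sqr_ge0. Qed.

Lemma norm_lt_sqrt1D x : `|x| < Num.sqrt (1 + x ^+ 2).
Proof.
by rewrite -sqrtr_sqr ltr_sqrt ?ltrDr// ltr_pwDl// sqr_ge0.
Qed.

Lemma expR_asinh x : expR (asinh x) = x + Num.sqrt (1 + x ^+ 2).
Proof.
rewrite /asinh lnK// posrE; have := norm_lt_sqrt1D x.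
by rewrite ltr_norml => /andP[]; lra.
Qed.

Lemma expRN_asinh x : expR (- asinh x) = Num.sqrt (1 + x ^+ 2) - x.
Proof.
apply: (mulfI (lt0r_neq0 (expR_gt0 (asinh x)))).
rewrite -expRD subrr expR0 expR_asinh.
by have := sqr_sqrt1D x; lra.
Qed.

Lemma asinh0 : asinh 0 = 0.
Proof. by rewrite /asinh expr0n addr0 add0r sqrtr1 ln1. Qed.

(** At [r = 0] division returns 0, which agrees with [asinh 0 = 0]. *)
Lemma asinh_divK r : asinh r / r * r = asinh r.
Proof. by have [->|r0] := eqVneq r 0; rewrite ?mulr0 ?asinh0 ?divfK. Qed.

Lemma asinh_ge0 r : 0 <= r -> 0 <= asinh r.
Proof.
move=> r0; rewrite /asinh ln_ge0// -[leLHS]add0r lerD//.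
by rewrite -sqrtr1 ler_wsqrtr// sqrtr1 lerDl sqr_ge0.
Qed.

Lemma cosh_asinhB r s :
  cosh (asinh r - asinh s) =
  Num.sqrt (1 + r ^+ 2) * Num.sqrt (1 + s ^+ 2) - r * s.
Proof.
by rewrite /cosh opprB !expRD !expR_asinh !expRN_asinh; field.
Qed.

Lemma cosh_asinhD r s :
  cosh (asinh r + asinh s) =
  Num.sqrt (1 + r ^+ 2) * Num.sqrt (1 + s ^+ 2) + r * s.
Proof.
by rewrite /cosh opprD !expRD !expR_asinh !expRN_asinh; field.
Qed.

Lemma sqrt1DM_le r s :
  Num.sqrt (1 + r ^+ 2) * Num.sqrt (1 + s ^+ 2) <= 1 + (r ^+ 2 + s ^+ 2) / 2.
Proof.
have := sqr_sqrt1D r; have := sqr_sqrt1D s.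
set p := Num.sqrt _; set q := Num.sqrt _ => hp hq.
have := sqr_ge0 (q - p); rewrite sqrrB hp hq; lra.
Qed.

(** The tangent to [cosh] at [asinh a] has slope [sinh (asinh a) = a]. *)
Lemma asinh_argmax a b : a * b - cosh b <= a * asinh a - cosh (asinh a).
Proof.
have := cosh_tangent_le b (asinh a); rewrite expR_asinh expRN_asinh; lra.
Qed.

Lemma exprn_convex l a b n : 0 <= l <= 1 -> 0 <= a -> 0 <= b ->
  (l * a + (1 - l) * b) ^+ n <= l * a ^+ n + (1 - l) * b ^+ n.
Proof.
move=> /andP[l0 l1] a0 b0; elim: n => [|n IH]; first by rewrite !expr0; lra.
have t0 : 0 <= l * a + (1 - l) * b.
  by rewrite addr_ge0// mulr_ge0// subr_ge0.
rewrite exprS (le_trans (ler_wpM2l t0 IH))// -subr_ge0.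
(* The defect in the induction step is a product in which [a - b] and [a ^+ n - b ^+ n] have the
   same sign. *)
have -> : l * a ^+ n.+1 + (1 - l) * b ^+ n.+1 -
    (l * a + (1 - l) * b) * (l * a ^+ n + (1 - l) * b ^+ n) =
    l * (1 - l) * ((a - b) * (a ^+ n - b ^+ n)) by rewrite !exprS; ring.
apply: mulr_ge0; first by rewrite mulr_ge0// subr_ge0.
have [ab|/ltW ba] := leP a b.
  by rewrite mulr_le0// subr_le0// lerXn2r.
by rewrite mulr_ge0// subr_ge0// lerXn2r.
Qed.

(** Convexity of [cosh (sqrt t)], phrased with squares so that [x], [a], [b] may have any sign. The
    partial sums of the power series are compared term by term. *)
Lemma cosh_sqrt_convex l x a b : 0 <= l <= 1 ->
  x ^+ 2 = l * a ^+ 2 + (1 - l) * b ^+ 2 ->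
  cosh x <= l * cosh a + (1 - l) * cosh b.
Proof.
move=> l01 xab.
pose S (z : R) : nat -> R := series (exp_coeff z) \+ series (exp_coeff (- z)).
have cvgS z : S z @ \oo --> 2 * cosh z.
  rewrite (_ : 2 * cosh z = expR z + expR (- z)); last by rewrite /cosh; lra.
  by apply: cvgD; exact: is_cvg_series_exp_coeff.
suff : 2 * cosh x <= l * (2 * cosh a) + (1 - l) * (2 * cosh b).
  by rewrite !(mulrCA _ 2) -mulrDr ler_pM2l.
apply: (@ler_cvg_to _ \oo _ _ _ (fun n => l * S a n + (1 - l) * S b n) _ _ (cvgS x)).
  by apply: cvgD; apply: cvgMr; exact: cvgS.
apply: nearW => n; rewrite /= /S /series /= -!big_split/= !mulr_sumr -big_split/=.
apply: ler_sum => k _; rewrite /exp_coeff /= -!mulrDl !mulrA -mulrDl.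
rewrite ler_wpM2r// ?invr_ge0 ?ler0n//.
(* The [k]-th numerator [z ^+ k + (- z) ^+ k] vanishes for odd [k]; for even [k] it is twice a power
   of [z ^+ 2], where [exprn_convex] applies. *)
rewrite -(odd_double_half k) -mul2n !(exprD _ (odd k)) !exprM !sqrrN xab.
case: (odd k); first by rewrite !expr1; lra.
rewrite !expr0 !mul1r; have := exprn_convex k./2 l01 (sqr_ge0 a) (sqr_ge0 b); lra.
Qed.

End HyperbolicFunctions.

(** * Euclidean geometry and gradients of conjugates *)

Section EuclideanSpace.
Variables (R : realType) (n : nat).
Implicit Types u v w y z : 'rV[R]_n.

Lemma dotC u v : dot u v = dot v u.
Proof. by apply: eq_bigr => i _; rewrite mulrC. Qed.

Lemma dotDl u v w : dot (u + v) w = dot u w + dot v w.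
Proof. by rewrite -big_split; apply: eq_bigr => i _; rewrite mxE mulrDl. Qed.

Lemma dotZl a u w : dot (a *: u) w = a * dot u w.
Proof. by rewrite mulr_sumr; apply: eq_bigr => i _; rewrite mxE mulrA. Qed.

Lemma dotBl u v w : dot (u - v) w = dot u w - dot v w.
Proof. by rewrite dotDl -scaleN1r dotZl mulN1r. Qed.

Lemma dotZr a u w : dot u (a *: w) = a * dot u w.
Proof. by rewrite dotC dotZl dotC. Qed.

Lemma dotBr u v w : dot w (u - v) = dot w u - dot w v.
Proof. by rewrite dotC dotBl !(dotC _ w). Qed.

Lemma dot_delta i u : dot (delta_mx 0 i) u = u 0 i.
Proof.
rewrite /dot (bigD1 i)//= big1 ?addr0 => [|j /negPf ji].
  by rewrite mxE !eqxx mul1r.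
by rewrite mxE eqxx ji mul0r.
Qed.

Lemma dotvv_ge0 u : 0 <= dot u u.
Proof. by apply: sumr_ge0 => i _; rewrite -expr2 sqr_ge0. Qed.

Lemma enorm_ge0 u : 0 <= enorm u.
Proof. exact: sqrtr_ge0. Qed.

Lemma enorm_sqr u : enorm u ^+ 2 = dot u u.
Proof. by rewrite sqr_sqrtr// dotvv_ge0. Qed.

Lemma coord_sqr_le u i : u 0 i ^+ 2 <= enorm u ^+ 2.
Proof.
rewrite enorm_sqr /dot (bigD1 i)//= -expr2 lerDl sumr_ge0// => j _.
by rewrite -expr2 sqr_ge0.
Qed.

Lemma enormZ a u : enorm (a *: u) = `|a| * enorm u.
Proof.
rewrite /enorm dotZl dotZr mulrA -expr2 sqrtrM ?sqr_ge0//.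
by rewrite sqrtr_sqr.
Qed.

Lemma enorm_delta i : enorm (delta_mx 0 i : 'rV[R]_n) = 1.
Proof. by rewrite /enorm dot_delta mxE !eqxx sqrtr1. Qed.

Lemma enorm_eq0 u : enorm u = 0 -> u = 0.
Proof.
move=> u0; apply/rowP => i; rewrite mxE; apply/eqP.
rewrite -sqrf_eq0 eq_le sqr_ge0 andbT (le_trans (coord_sqr_le u i))//.
by rewrite u0 expr0n.
Qed.

Lemma cauchy_schwarz u v : `|dot u v| <= enorm u * enorm v.
Proof.
wlog duv : u / 0 <= dot u v => [hw|].
  have [/hw//|/ltW d0] := leP 0 (dot u v).
  have := hw (- u); rewrite -scaleN1r dotZl enormZ normrM normrN1 !mul1r.
  by apply; lra.
rewrite ger0_norm//.
have [/enorm_eq0 ->|un0] := eqVneq (enorm u) 0.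
  by rewrite -(scale0r 0) dotZl mul0r mulr_ge0// enorm_ge0.
have [/enorm_eq0 ->|vn0] := eqVneq (enorm v) 0.
  by rewrite -(scale0r 0) dotZr mul0r mulr_ge0// enorm_ge0.
have uv0 : 0 < enorm u * enorm v by rewrite mulr_gt0// lt0r enorm_ge0 andbT.
(* Expanding gives [0 <= 2 |u| |v| (|u| |v| - dot u v)], and the positive factor [|u| |v|]
   cancels. *)
have := dotvv_ge0 (enorm v *: u - enorm u *: v).
rewrite !dotBl !dotBr !dotZl !dotZr (dotC v u) -!enorm_sqr => h.
rewrite -(ler_pM2l uv0); nra.
Qed.

Lemma dot_cosine u v :
  {c | -1 <= c <= 1 & dot u v = c * (enorm u * enorm v)}.
Proof.
(* If a norm vanishes, this quotient is 0 by convention, and [dot u v = 0] by Cauchy-Schwarz. *)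
exists (dot u v / (enorm u * enorm v)); have := cauchy_schwarz u v.
  have [->|nz] := eqVneq (enorm u * enorm v) 0.
    by rewrite invr0 mulr0 => _; apply/andP; split; lra.
  have p0 : 0 < enorm u * enorm v by rewrite lt0r nz mulr_ge0 ?enorm_ge0.
  by rewrite -ler_norml normrM normfV (gtr0_norm p0) ler_pdivrMr ?mul1r.
have [->|nz _] := eqVneq (enorm u * enorm v) 0; last by rewrite divfK.
by rewrite normr_le0 => /eqP ->; rewrite mulr0.
Qed.

Lemma enorm_continuous : continuous (@enorm R n).
Proof.
move=> u; apply: (@continuous_comp _ _ _ (fun v => dot v v) Num.sqrt).
  apply: (@continuous_big _ _ _ _ _ _ _ _ (fun i v => v 0 i * v 0 i)) => [|i _ v].
    exact: add_continuous.
  by apply: continuousM; exact: coord_continuous.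
exact: sqrt_continuous.
Qed.

Lemma fine_convex_conjugate (phi : 'rV[R]_n -> R) (y x : 'rV[R]_n) :
  (forall z, dot y z - phi z <= dot y x - phi x) ->
  fine (convex_conjugate phi y) = dot y x - phi x.
Proof.
move=> xmax; rewrite (_ : convex_conjugate phi y = (dot y x - phi x)%:E)//.
apply/eqP; rewrite eq_le; apply/andP; split.
  by apply: ge_ereal_sup => _ [z _ <-]; rewrite lee_fin.
by apply: ereal_sup_ubound; exists x.
Qed.

Lemma grad_conjugate_argmax (phi : 'rV[R]_n -> R) (x : 'rV[R]_n -> 'rV[R]_n) :
  (forall y z, dot y z - phi z <= dot y (x y) - phi (x y)) ->
  (forall v i, v 0 i ^+ 2 <= 8 * phi v) ->
  (forall y ybar, phi (x y - x ybar) <= 1 / 2 * enorm (y - ybar) ^+ 2) ->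
  grad_conjugate phi = x.
Proof.
move=> xmax phi_ge xlip; apply/funext => y.
have conjE z := fine_convex_conjugate (xmax z).
(* The two bounds combine to a squared Lipschitz constant [8 * (1 / 2) = 2 ^ 2]. *)
have xcont z i : `|x z 0 i - x y 0 i| <= 2 * enorm (z - y).
  rewrite -(@ger0_norm _ (2 * _)); last by rewrite mulr_ge0// enorm_ge0.
  rewrite -ler_sqr ?nnegrE// !real_normK ?num_real// exprMn.
  have := phi_ge (x z - x y) i; have := xlip z y; rewrite !mxE; lra.
apply/rowP => i; rewrite /grad_conjugate mxE /derive.
apply: cvg_lim => //; apply/cvgrPdist_le => e e0.
near=> h.
have h0 : h != 0 by near: h; exact: nbhs_dnbhs_neq.
rewrite /= !conjE; set z := h *: _ + y.
have zy : z - y = h *: delta_mx 0 i by rewrite addrK.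
have dz w : dot z w = dot y w + h * w 0 i.
  by rewrite -[z](subrK y) zy dotDl dotZl dot_delta addrC.
(* With [z = y + h e_i], these two say that the increment of the conjugate lies between
   [h * x y 0 i] and [h * x z 0 i]. *)
have lower := xmax z (x y); have upper := xmax y (x z).
have := xcont z i; rewrite zy enormZ enorm_delta mulr1 => xz.
rewrite (_ : _ *: _ = h^-1 * (dot z (x z) - phi (x z) - (dot y (x y) - phi (x y))))//.
have nh : 0 < `|h| by rewrite normr_gt0.
rewrite -(ler_pM2l nh) -normrM mulrBr mulVKf//.
apply: (@le_trans _ _ (`|h| * `|x z 0 i - x y 0 i|)).
  rewrite -normrM !dz in lower upper *; rewrite ler_norml; apply/andP; split.
    by have := ler_norm (h * (x z 0 i - x y 0 i)); nra.
  by have := normr_ge0 (h * (x z 0 i - x y 0 i)); nra.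
rewrite ler_pM2l// (le_trans xz)//.
have : `|h| <= e / 2 by near: h; apply: dnbhs0_le; rewrite divr_gt0.
lra.
Unshelve. all: by end_near. Qed.

(** * The explicit maximisers for the two choices of [phi] *)

Definition asinh_coord y : 'rV[R]_n := \row_i asinh (y 0 i).

Lemma asinh_coord_argmax y z :
  dot y z - cosh_sum z <= dot y (asinh_coord y) - cosh_sum (asinh_coord y).
Proof.
rewrite /dot /cosh_sum -!sumrB; apply: ler_sum => i _; rewrite mxE.
have := asinh_argmax (y 0 i) (z 0 i); lra.
Qed.

Lemma coord_sqr_le_cosh_sum y i : y 0 i ^+ 2 <= 8 * cosh_sum y.
Proof.
apply: (le_trans (sqr_le_cosh _)); rewrite ler_pM2l// /cosh_sum (bigD1 i)//=.
by rewrite lerDl sumr_ge0// => j _; rewrite subr_ge0 cosh_ge1.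
Qed.

Lemma cosh_sum_asinh_coordB y z :
  cosh_sum (asinh_coord y - asinh_coord z) <= 1 / 2 * enorm (y - z) ^+ 2.
Proof.
rewrite enorm_sqr mulr_sumr; apply: ler_sum => i _; rewrite !mxE cosh_asinhB.
have := sqrt1DM_le (y 0 i) (z 0 i); lra.
Qed.

(* At [y = 0] the scalar is [0 / 0 = 0]. *)
Definition asinh_radial y : 'rV[R]_n := (asinh (enorm y) / enorm y) *: y.

Lemma enorm_asinh_radial y : enorm (asinh_radial y) = asinh (enorm y).
Proof.
rewrite enormZ ger0_norm ?asinh_divK//.
by rewrite divr_ge0 ?asinh_ge0 ?enorm_ge0.
Qed.

(** Cauchy-Schwarz, an equality along [y], reduces this to [asinh_argmax] at the norms. *)
Lemma asinh_radial_argmax y z :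
  dot y z - cosh_enorm z <= dot y (asinh_radial y) - cosh_enorm (asinh_radial y).
Proof.
rewrite /cosh_enorm enorm_asinh_radial dotZr -enorm_sqr expr2 mulrA asinh_divK.
have := asinh_argmax (enorm y) (enorm z).
have := le_trans (ler_norm _) (cauchy_schwarz y z); lra.
Qed.

Lemma coord_sqr_le_cosh_enorm y i : y 0 i ^+ 2 <= 8 * cosh_enorm y.
Proof. exact: le_trans (coord_sqr_le y i) (sqr_le_cosh _). Qed.

Lemma cosh_enorm_asinh_radialB y z :
  cosh_enorm (asinh_radial y - asinh_radial z) <= 1 / 2 * enorm (y - z) ^+ 2.
Proof.
have [c c1 dotyz] := dot_cosine y z.
have dotX : dot (asinh_radial y) (asinh_radial z) =
    c * (asinh (enorm y) * asinh (enorm z)).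
  rewrite dotZl dotZr dotyz -[in RHS](asinh_divK (enorm y)).
  by rewrite -[in RHS](asinh_divK (enorm z)); ring.
have sqB u v : enorm (u - v) ^+ 2 = enorm u ^+ 2 + enorm v ^+ 2 - 2 * dot u v.
  by rewrite !enorm_sqr dotBl !dotBr (dotC v u); ring.
(* With [A], [B] the norms of the maximisers, [A^2 + B^2 - 2cAB] is the mean of [(A - B)^2] and
   [(A + B)^2] with weights [(1 + c) / 2] and [(1 - c) / 2]. *)
have c01 : 0 <= (1 + c) / 2 <= 1 by lra.
have := @cosh_sqrt_convex R ((1 + c) / 2)
  (enorm (asinh_radial y - asinh_radial z))
  (asinh (enorm y) - asinh (enorm z)) (asinh (enorm y) + asinh (enorm z)) c01.
rewrite sqB !enorm_asinh_radial dotX cosh_asinhB cosh_asinhD => /(_ _)/wrap[].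
  by field.
rewrite sqB dotyz /cosh_enorm => h.
(* In the weighted mean of the two [cosh] values, the products [|y| |z|] add up to
   [- c |y| |z| = - dot y z]. *)
have := sqrt1DM_le (enorm y) (enorm z); lra.
Qed.

End EuclideanSpace.

(** * Measurability and passage to expectations *)

Section RandomVectors.
Context {R : realType} (n : nat) (d : measure_display) (T : measurableType d).

Lemma measurable_continuous_random_vector (X : T -> 'rV[R]_n)
    (h : 'rV[R]_n -> R) :
  random_vector X -> continuous h -> measurable_fun [set: T] (h \o X).
Proof.
move=> mX /continuousP hc.
apply: (measurability _ (RGenOpens.measurableE R)) => _ [_ [a [b ->] <-]].
rewrite comp_preimage; apply: mX => //; apply: sub_sigma_algebra.
by apply: hc; exact: interval_open.
Qed.

End RandomVectors.

(* Only the larger function has to be measurable: the integral of a nonnegative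
   function is a supremum over the simple functions below it. *)
Lemma ge0_le_integral_dominated (d : measure_display) (T : measurableType d)
    (R : realType) (mu : {measure set T -> \bar R}) (f1 f2 : T -> \bar R) :
  (forall t, 0 <= f1 t)%E -> (forall t, f1 t <= f2 t)%E ->
  (\int[mu]_t f1 t <= \int[mu]_t f2 t)%E.
Proof.
move=> f10 f12; have f20 t : (0 <= f2 t)%E := le_trans (f10 t) (f12 t).
rewrite !ge0_integralTE//; apply: le_ereal_sup => _ [h hf1 <-].
by exists h => // t; exact: le_trans (hf1 t) (f12 t).
Qed.

Theorem proposition3p2 (R : realType) (n : nat) (phi : 'rV[R]_n -> R)
    (hphi : phi = @cosh_sum R n \/ phi = @cosh_enorm R n) :
  (forall y ybar : 'rV[R]_n,
     phi (grad_conjugate phi y - grad_conjugate phi ybar)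
       <= 1 / 2 * enorm (y - ybar) ^+ 2) /\
  (forall (d : measure_display) (T : measurableType d) (P : probability T R)
     (f : 'rV[R]_n -> R) (x : 'rV[R]_n) (g : 'rV[R]_n -> T -> 'rV[R]_n)
     (sigma : R),
     continuously_differentiable f ->
     random_vector (g x) ->
     ('E_P[(fun w => enorm (gradient f x - g x w) ^+ 2)%R]
        <= (sigma ^+ 2)%:E)%E ->
     ('E_P[(fun w => phi (grad_conjugate phi (gradient f x)
                          - grad_conjugate phi (g x w)))%R]
        <= (sigma ^+ 2 / 2)%:E)%E).
Proof.
have [phi_ge0 le_phi] : (forall v, 0 <= phi v) /\
    forall y ybar, phi (grad_conjugate phi y - grad_conjugate phi ybar)
       <= 1 / 2 * enorm (y - ybar) ^+ 2.
  case: hphi => ->; split.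
  - by move=> v; apply: sumr_ge0 => i _; rewrite subr_ge0 cosh_ge1.
  (* The inequality for the maximiser serves twice: it identifies the maximiser with the gradient of
     the conjugate, and it is then the claim itself. *)
  - rewrite (grad_conjugate_argmax (@asinh_coord_argmax R n)).
    + exact: cosh_sum_asinh_coordB.
    + exact: coord_sqr_le_cosh_sum.
    + exact: cosh_sum_asinh_coordB.
  - by move=> v; rewrite subr_ge0 cosh_ge1.
  - rewrite (grad_conjugate_argmax (@asinh_radial_argmax R n)).
    + exact: cosh_enorm_asinh_radialB.
    + exact: coord_sqr_le_cosh_enorm.
    + exact: cosh_enorm_asinh_radialB.
split=> // d T P f x g sigma _ mg; rewrite !unlock => Eg.
apply: (@le_trans _ _ (\int[P]_w
    ((1 / 2)%:E * (enorm (gradient f x - g x w) ^+ 2)%:E))%E).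
  apply: ge0_le_integral_dominated => w; first by rewrite lee_fin.
  by rewrite -EFinM lee_fin.
rewrite ge0_integralZl_EFin//.
- rewrite [leRHS](_ : _ = (1 / 2)%:E * (sigma ^+ 2)%:E)%E ?lee_pmul2l//.
  by rewrite -EFinM; congr EFin; lra.
- by move=> w _; rewrite lee_fin sqr_ge0.
(* The dominating integrand is a continuous function of the random vector [g x]. *)
- apply/measurable_EFinP; apply: measurable_funX.
  apply: (@measurable_continuous_random_vector _ _ _ _ (g x)
    (fun v => enorm (gradient f x - v))) => // v.
  apply: (@continuous_comp 'rV[R]_n 'rV[R]_n R (fun v => gradient f x - v) (@enorm R n)).
    by apply: (@cvgB _ _ _ (nbhs v)); [exact: cvg_cst|exact: cvg_id].
  exact: enorm_continuous.
Qed.
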